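(* For every integer $d\ge 1$, as formal power series in $q$, $$\sum_{n=0}^\infty s_d(n)q^n=\prod_{n=1}^\infty\frac{A_d(q^n)}{(1-q^n)^{d+1}},$$ where $s_d(n)$ is the number of Schmidt type $d$-fold partition diamonds of $n$ and $A_d(q)$ is the $d$th Eulerian polynomial.
   Context: Let $d\ge 1$ be an integer. A $d$-fold partition diamond consists of non-negative integers $a_i$ ($i\ge 0$) and $b_{i,j}$ ($i\ge 1$, $1\le j\le d$), only finitely many of which are nonzero, such that $a_{i-1}\ge b_{i,j}\ge a_i$ for all $i\ge1$ and $1\le j\le d$. For a Schmidt type $d$-fold partition diamond of $n$, only the links $a_i$ are summed: it is such a configuration with $\sum_{i\ge0}a_i=n$ (the $b_{i,j}$ are omitted from the sum, but configurations with different $b_{i,j}$ are counted as different). Let $s_d(n)$ be the number of Schmidt type $d$-fold partition diamonds of $n$. The Eulerian polynomials are defined by $A_0(q)=1$ and, for all $d\ge1$, $$A_d(q)=(1+(d-1)q)A_{d-1}(q)+q(1-q)A'_{d-1}(q).$$ *)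

(* Defs.v *)
From HB Require Import structures.
From mathcomp Require Import all_boot all_order all_algebra finmap.
From mathcomp Require Import boolp classical_sets functions cardinality fsbigop.
From mathcomp Require Import filter.

Set Implicit Arguments.
Unset Strict Implicit.
Unset Printing Implicit Defensive.

Import Order.TTheory GRing.Theory Num.Theory.

Local Open Scope classical_set_scope.
Local Open Scope ring_scope.

(* [D.1 i] is a_i for i >= 0, but the indices of the second family are shifted *)
(* so as to start from 0: [D.2 i j] stands for b_{i+1,j+1}.                    *)
Definition diamond (d : nat) : Type := (nat -> nat) * (nat -> 'I_d -> nat).

Definition partition_diamond d (D : diamond d) : Prop :=
  [/\ finite_set [set i | D.1 i != 0%N],
      finite_set [set ij : nat * 'I_d | D.2 ij.1 ij.2 != 0%N] &
      forall i j, (D.1 i.+1 <= D.2 i j <= D.1 i)%N].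

Definition schmidt_diamonds (d n : nat) : set (diamond d) :=
  [set D | partition_diamond D /\
           \big[addn/0%N]_(i \in [set: nat]) D.1 i = n].
Arguments schmidt_diamonds : clear implicits.

(* [fset_set] is empty on infinite sets; by [finite_schmidt_diamonds] this     *)
(* default value is only used for d = 0.                                       *)
Definition schmidt_count (d n : nat) : nat :=
  #|` fset_set (schmidt_diamonds d n) |.

Lemma schmidt_diamonds_bound d n (D : diamond d) : (0 < d)%N ->
  schmidt_diamonds d n D -> forall i, (D.1 i <= if i < n then n else 0)%N.
Proof.
case: d D => // d [a b] _ [[/= fa _ ab] sum_a].
have amono i k : (i <= k)%N -> (a k <= a i)%N.
  elim: k => [|k IHk]; first by rewrite leqn0 => /eqP->.
  rewrite leq_eqVlt => /orP[/eqP->//|/ltnSE/IHk]; apply: leq_trans.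
  by have /andP[/leq_trans] := ab k ord0; apply.
have ge_sum (s : seq nat) : uniq s -> (\sum_(i <- s) a i <= n)%N.
  move=> us; rewrite -sum_a.
  have finS : finite_set ([set: nat] `&` a @^-1` [set~ 0%N]).
    by rewrite setTI; apply: sub_finite_set fa => i /= /eqP.
  rewrite (bigID (fun i => a i != 0%N)) /= [X in (_ + X)%N]big1 ?addn0; last first.
    by move=> i /negPn/eqP.
  rewrite -big_filter; set s' := [seq i <- s | a i != 0%N].
  apply: (@leq_trans
    (\sum_(i <- finite_support 0%N [set: nat] a | i \in s') a i)); last first.
    by rewrite [X in (_ <= X)%N](bigID [in s']) /= leq_addr.
  rewrite -[X in (_ <= X)%N]big_filter; apply/eq_leq/perm_big/uniq_perm.
  - exact: filter_uniq.
  - by apply: filter_uniq; apply: finite_support_uniq.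
  move=> i; rewrite [in RHS]mem_filter mem_filter andbC.
  case: (i \in s) => //=; case: eqP => //= ai; apply/esym.
  by rewrite in_finite_support //; apply/mem_set; split.
move=> i /=; case: ltnP => lt_in.
  by have := ge_sum [:: i] isT; rewrite big_seq1.
case: (posnP (a i)) => [->//|ai_gt0].
have := ge_sum (iota 0 n.+1) (iota_uniq _ _).
have lt_sum : (n.+1 <= \sum_(k <- iota 0 n.+1) a k)%N.
  rewrite -[X in (X <= _)%N](size_iota 0 n.+1) -sum1_size big_seq.
  rewrite [X in (_ <= X)%N]big_seq; apply: leq_sum => k.
  rewrite mem_iota add0n ltnS => /andP[_ le_kn].
  exact: leq_trans (amono _ _ (leq_trans le_kn lt_in)).
by move=> /(leq_trans lt_sum); rewrite ltnn.
Qed.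

Lemma finite_schmidt_diamonds d n : (0 < d)%N ->
  finite_set (schmidt_diamonds d n).
Proof.
move=> d_gt0.
pose g (x : {ffun 'I_n.+1 -> 'I_n.+1} * {ffun 'I_n.+1 * 'I_d -> 'I_n.+1}) :
    diamond d :=
  (fun i => if (i < n)%N then x.1 (inord i) : nat else 0%N,
   fun i j => if (i < n)%N then x.2 (inord i, j) : nat else 0%N).
apply: (@sub_finite_set _ _ (g @` setT)); last exact: finite_image.
move=> [a b] Dab; have /= bnd := schmidt_diamonds_bound d_gt0 Dab.
have [[_ _ /= ab] _] := Dab.
exists ([ffun i : 'I_n.+1 => inord (a i)],
  [ffun ij : 'I_n.+1 * 'I_d => inord (b ij.1 ij.2)]) => //.
congr pair; apply/funext => i /=.
  have := bnd i; case: ltnP => [lt_in le_an | _]; last by case: (a i).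
  by rewrite ffunE !inordK // ltnS // ltnW.
apply/funext => j; have /andP[_ /leq_trans/(_ (bnd i))] := ab i j.
case: ltnP => [lt_in le_bn | _]; last by case: (b i j).
by rewrite ffunE /= !inordK // ltnS // ltnW.
Qed.

Fixpoint eulerian (d : nat) : {poly int} :=
  if d is e.+1 then
    (1 + e%:R *: 'X) * eulerian e + 'X * (1 - 'X) * (eulerian e)^`()
  else 1.

(* Formal power series, with the Cauchy product; a series is a unit iff its   *)
(* constant term is a unit of R. The inverse of c * (1 - h), with c a unit    *)
(* and h of zero constant term, is c^-1 * (1 + h + h^2 + ...), whose          *)
(* coefficient of degree n only involves the powers of h up to h^n.           *)
Record fps (R : Type) := Fps { fcoef :> nat -> R }.

Lemma fpsP R (f g : fps R) : f =1 g -> f = g.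
Proof. by case: f g => [f] [g] /= /funext->. Qed.

HB.instance Definition _ (R : Type) := gen_eqMixin (fps R).
HB.instance Definition _ (R : Type) := gen_choiceMixin (fps R).

Section FpsZmodule.
Variable R : zmodType.
Implicit Types f g h : fps R.

Definition fps_zero : fps R := Fps (fun=> 0).
Definition fps_opp f : fps R := Fps (fun n => - f n).
Definition fps_add f g : fps R := Fps (fun n => f n + g n).

Fact fps_addA : associative fps_add.
Proof. by move=> f g h; apply: fpsP => n /=; rewrite addrA. Qed.
Fact fps_addC : commutative fps_add.
Proof. by move=> f g; apply: fpsP => n /=; rewrite addrC. Qed.
Fact fps_add0 : left_id fps_zero fps_add.
Proof. by move=> f; apply: fpsP => n /=; rewrite add0r. Qed.
Fact fps_addN : left_inverse fps_zero fps_opp fps_add.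
Proof. by move=> f; apply: fpsP => n /=; rewrite addNr. Qed.

HB.instance Definition _ := GRing.isZmodule.Build (fps R)
  fps_addA fps_addC fps_add0 fps_addN.

Lemma fps0E n : (0 : fps R) n = 0. Proof. by []. Qed.
Lemma fpsNE f n : (- f) n = - f n. Proof. by []. Qed.
Lemma fpsDE f g n : (f + g) n = f n + g n. Proof. by []. Qed.

Lemma fps_sumE I (r : seq I) (P : pred I) (F : I -> fps R) n :
  (\sum_(i <- r | P i) F i) n = \sum_(i <- r | P i) F i n.
Proof. by elim/big_rec2: _ => // i x f _ <-. Qed.
End FpsZmodule.

Section FpsRing.
Variable R : comUnitRingType.
Implicit Types (f g h : fps R) (p q : {poly R}).

Definition fps_of_poly p : fps R := Fps (fun n => p`_n).
Definition fps_one : fps R := Fps (fun n => (n == 0)%:R).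
Definition fps_mul f g : fps R :=
  Fps (fun n => \sum_(i < n.+1) f i * g (n - i)%N).

Let tr n f : {poly R} := \poly_(i < n.+1) f i.

Let trE n f i : (i <= n)%N -> (tr n f)`_i = f i.
Proof. by move=> le_in; rewrite coef_poly ltnS le_in. Qed.

Let fps_mulE n f g i p q : (i <= n)%N ->
  (forall k, (k <= n)%N -> p`_k = f k) ->
  (forall k, (k <= n)%N -> q`_k = g k) -> fps_mul f g i = (p * q)`_i.
Proof.
move=> le_in pf qg; rewrite coefM; apply: eq_bigr => k _.
by rewrite pf ?qg // ?(leq_trans (leq_subr _ _)) // (leq_trans (leq_ord k)).
Qed.

Fact fps_mulC : commutative fps_mul.
Proof.
by move=> f g; apply: fpsP => n; rewrite !(fps_mulE (leqnn n) (@trE n _) (@trE n _)) mulrC.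
Qed.

Fact fps_mulA : associative fps_mul.
Proof.
move=> f g h; apply: fpsP => n.
rewrite (@fps_mulE n _ _ _ (tr n f) (tr n g * tr n h)) ?mulrA //; last first.
- by move=> k le_kn; rewrite (fps_mulE le_kn (@trE n _) (@trE n _)).
- exact: trE.
rewrite (@fps_mulE n _ _ _ (tr n f * tr n g) (tr n h)) //; last first.
- exact: trE.
- by move=> k le_kn; rewrite (fps_mulE le_kn (@trE n _) (@trE n _)).
Qed.

Fact fps_mul1 : left_id fps_one fps_mul.
Proof.
move=> f; apply: fpsP => n /=; rewrite big_ord_recl subn0 mul1r big1 ?addr0 //.
by move=> i _; rewrite mul0r.
Qed.

Fact fps_mulDl : left_distributive fps_mul +%R.
Proof.
move=> f g h; apply: fpsP => n; rewrite fpsDE /= -big_split /=.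
by apply: eq_bigr => i _; rewrite mulrDl.
Qed.

Fact fps_one_neq0 : fps_one != 0.
Proof.
by apply/eqP => /(congr1 (fun f : fps R => f 0%N))/eqP; rewrite (negPf (oner_neq0 _)).
Qed.

HB.instance Definition _ := GRing.Zmodule_isComNzRing.Build (fps R)
  fps_mulA fps_mulC fps_mul1 fps_mulDl fps_one_neq0.

Lemma fps1E n : (1 : fps R) n = (n == 0)%:R. Proof. by []. Qed.
Lemma fpsME f g n : (f * g) n = \sum_(i < n.+1) f i * g (n - i)%N.
Proof. by []. Qed.

Definition fps_unit : {pred fps R} := [pred f : fps R | f 0%N \is a GRing.unit].
Definition fps_inv f : fps R :=
  if f \in fps_unit then
    let h : fps R := 1 - fps_of_poly (f 0%N)^-1%:P * f in
    Fps (fun n => (f 0%N)^-1 * \sum_(i < n.+1) (h ^+ i) n)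
  else f.

Let exp_lt h i n : h 0%N = 0 -> (n < i)%N -> (h ^+ i) n = 0.
Proof.
move=> h0; elim: i n => // i IHi n lt_ni; rewrite exprS fpsME big1 // => k _.
have [->|k_gt0] := posnP k; first by rewrite h0 mul0r.
rewrite IHi ?mulr0 //; apply: leq_trans (ltnSE lt_ni).
by rewrite ltn_subrL k_gt0 (leq_trans k_gt0 (leq_ord k)).
Qed.

Let fps_polyCM (c : R) f n : (fps_of_poly c%:P * f) n = c * f n.
Proof.
rewrite fpsME big_ord_recl subn0 /= coefC eqxx big1 ?addr0 // => i _.
by rewrite coefC mul0r.
Qed.

Fact fps_mulVr : {in fps_unit, left_inverse 1 fps_inv *%R}.
Proof.
move=> f fU; rewrite /fps_inv fU; set c := (f 0%N)^-1.
set h := 1 - _; set g := Fps _; apply: fpsP => n.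
have h0 : h 0%N = 0.
  by rewrite fpsDE fpsNE fps_polyCM fps1E eqxx mulVr ?subrr.
pose s : fps R := \sum_(i < n.+1) h ^+ i.
have gE k : (k <= n)%N -> g k = (fps_of_poly c%:P * s) k.
  move=> le_kn; rewrite fps_polyCM /= fps_sumE; congr (_ * _).
  rewrite (big_ord_widen n.+1 (fun i => (h ^+ i) k)) // big_mkcond /=.
  apply: eq_bigr => i _; case: ltnP => // lt_ki.
  by rewrite exp_lt.
have -> : (g * f) n = (fps_of_poly c%:P * s * f) n.
  by rewrite !fpsME; apply: eq_bigr => k _; rewrite gE // (leq_ord k).
have -> : fps_of_poly c%:P * s * f = 1 - h ^+ n.+1.
  have -> : fps_of_poly c%:P * s * f = (1 - h) * s.
    by rewrite /h opprB addrC subrK mulrAC.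
  rewrite -[in RHS](expr1n _ n.+1) subrXX; congr (_ * _).
  by apply: eq_bigr => i _; rewrite expr1n mul1r.
by rewrite fpsDE fpsNE exp_lt // subr0.
Qed.

Fact fps_unitP f g : g * f = 1 -> f \in fps_unit.
Proof.
move=> /(congr1 (fun u : fps R => u 0%N)).
rewrite fpsME big_ord1 fps1E /= => gf.
by apply/unitrPr; exists (g 0%N); rewrite mulrC.
Qed.

Fact fps_inv_out : {in [predC fps_unit], fps_inv =1 id}.
Proof. by move=> f /negPf fU; rewrite /fps_inv fU. Qed.

HB.instance Definition _ := GRing.ComNzRing_hasMulInverse.Build (fps R)
  fps_mulVr fps_unitP fps_inv_out.

End FpsRing.

(* Convergence of the infinite product F 1 * F 2 * ... to f in the topology of *)
(* formal power series: each coefficient of the partial products is eventually *)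
(* equal to the corresponding coefficient of f.                                *)
Definition infprod_to (R : comUnitRingType) (F : nat -> fps R) (f : fps R) :=
  forall m, \forall N \near \oo, (\prod_(1 <= n < N.+1) F n) m = f m.

Definition schmidt_gf (d : nat) : fps int :=
  Fps (fun n => (schmidt_count d n)%:Z).

(* Main.v *)
From HB Require Import structures.
Require Import Defs.
From mathcomp Require Import all_boot all_order all_algebra.
From mathcomp Require Import finmap boolp classical_sets functions cardinality.
From mathcomp Require Import fsbigop filter.
From mathcomp Require Import ring zify.

Import GRing.Theory Num.Theory.
Local Open Scope ring_scope.

(** The n-th factor of the product is a power series with visible coefficients,
the generalized Worpitzky identity
  A_d(q^n) / (1 - q^n)^(d+1) = sum_(k >= 0) (k+1)^d q^(n k),
which follows by induction on d ([eulerian_pow_series]): the operator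
1 + theta / n, with theta = q d/dq, multiplies the coefficient of q^(n k) by
k + 1, and its effect on the numerator of the quotient on the left is the
recurrence of the Eulerian polynomials.

On the combinatorial side, a diamond is determined by the gaps
k_i = a_(i-1) - a_i, for i >= 1, together with the offsets b_(i,j) - a_i, which
are arbitrary integers between 0 and k_i: there are (k_i + 1)^d of them for
each i. Since a_i is the sum of the gaps k_l over l > i, the links add up to
sum_i i k_i. Hence the gaps and offsets at level n contribute exactly the series
above, and the levels are independent of each other.

For the coefficient of q^m, levels beyond m are trivial. So for N >= m both
sides count the finite set [level_codes d N m] of N-tuples of pairs (gap,
offsets) of total weight m: expanding the partial product counts it by
distributivity ([coef_prod_pow_series]), and decoding a tuple into a diamond
is a bijection onto the Schmidt type diamonds of m ([schmidt_count_codes]). *)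

(** * The Euler operator on formal power series *)

Section Series.
Context {R : comUnitRingType}.
Implicit Types (f g : fps R) (p : {poly R}).

Fact fps_of_poly_is_zmod_morphism : zmod_morphism (@fps_of_poly R).
Proof. by move=> p q; apply: fpsP => k; rewrite /= coefB. Qed.

Fact fps_of_poly_is_monoid_morphism : monoid_morphism (@fps_of_poly R).
Proof.
split=> [|p q]; apply: fpsP => k; first by rewrite /= coef1.
by rewrite fpsME /= coefM.
Qed.

HB.instance Definition _ := GRing.isZmodMorphism.Build _ _ (@fps_of_poly R)
  fps_of_poly_is_zmod_morphism.
HB.instance Definition _ := GRing.isMonoidMorphism.Build _ _ (@fps_of_poly R)
  fps_of_poly_is_monoid_morphism.

Lemma fps_mulrnE f n k : (f *+ n) k = f k *+ n.
Proof. by elim: n => // n IHn; rewrite !mulrS fpsDE IHn. Qed.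

(** The operator q d/dq, preferred to d/dq because it commutes, up to the factor
n, with the substitution of q^n for q. *)
Definition theta f : fps R := Fps (fun k => f k *+ k).

Lemma thetaB f g : theta (f - g) = theta f - theta g.
Proof. by apply: fpsP => k; rewrite /= mulrnBl. Qed.

Lemma thetaM f g : theta (f * g) = theta f * g + f * theta g.
Proof.
apply: fpsP => k; rewrite fpsDE !fpsME /= -sumrMnl -big_split /=.
apply: eq_bigr => i _; rewrite mulrnAl mulrnAr -mulrnDr subnKC //.
exact: leq_ord.
Qed.

Lemma theta1 : theta 1 = 0.
Proof. by apply: fpsP => -[|k]; rewrite /= ?mulr0n // mul0rn. Qed.

Lemma thetaX f k : theta (f ^+ k) = f ^+ k.-1 * theta f *+ k.
Proof.
elim: k => [|k IHk]; first by rewrite theta1 mulr0n.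
rewrite exprS thetaM {}IHk /=; case: k => [|k] /=.
  by rewrite expr0 !mulr1 mul1r mulr0n mulr0 addr0.
by rewrite exprS; ring.
Qed.

Lemma theta_poly p : theta (fps_of_poly p) = fps_of_poly ('X * p^`()).
Proof.
apply: fpsP => -[|k]; rewrite /= coefXM ?mulr0n //=.
by rewrite coef_deriv.
Qed.

End Series.

(** * The factors of the product *)

(** The series sum_(k >= 0) (k+1)^d q^(n k). *)
Definition pow_series (d n : nat) : fps int :=
  Fps (fun j => if (n %| j)%N then ((j %/ n).+1 ^ d)%N%:Z else 0).

(** A geometric series; it also shows that 1 - q^n is a unit. *)
Lemma pow_series0 n : (0 < n)%N -> pow_series 0 n * fps_of_poly (1 - 'X^n) = 1.
Proof.
move=> n_gt0; rewrite rmorphB rmorph1 mulrBr mulr1 [_ * fps_of_poly _]mulrC.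
apply: fpsP => j; rewrite fpsDE fpsNE fps1E.
have -> : (fps_of_poly 'X^n * pow_series 0 n) j =
    if (j < n)%N then 0 else pow_series 0 n (j - n)%N.
  rewrite fpsME; case: ltnP => [lt_jn|le_nj].
    apply: big1 => i _; rewrite /= coefXn.
    by case: eqP (ltn_ord i) => [?|]; [lia|rewrite mul0r].
  rewrite (bigD1 (inord n)) //= inordK // coefXn eqxx mul1r big1 ?addr0 //.
  move=> i /negP ni; rewrite coefXn; case: eqP => [ein|]; last by rewrite mul0r.
  by case: ni; apply/eqP/val_inj; rewrite /= -ein inord_val.
rewrite /= !expn0; case: ltnP => [lt_jn|le_nj].
  rewrite subr0; case: posnP lt_jn => [->|j_gt0 lt_jn]; first by rewrite dvdn0.
  by rewrite gtnNdvd //; case: j j_gt0 lt_jn.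
rewrite dvdn_subl //; have /negPf-> : j != 0%N by lia.
by case: ifP.
Qed.

Lemma pow_seriesS d n : (0 < n)%N ->
  pow_series d.+1 n *+ n = pow_series d n *+ n + theta (pow_series d n).
Proof.
move=> n_gt0; apply: fpsP => j; rewrite fpsDE !fps_mulrnE /=.
case: ifP => [/dvdnP[k ->]|_]; last by rewrite !mul0rn addr0.
by rewrite mulnK // expnS; lia.
Qed.

(** With y = q^n, S the series at d and z = 1 - y, the induction hypothesis is
A_d(y) = S z^(d+1). Applying theta to it expresses n y A_d'(y) through S and
theta S, and the recurrence then gives
n A_(d+1)(y) = (n S + theta S) z^(d+2). *)
Lemma eulerian_pow_series d n : (0 < n)%N ->
  fps_of_poly (eulerian d \Po 'X^n) =
  pow_series d n * fps_of_poly (1 - 'X^n) ^+ d.+1.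
Proof.
move=> n_gt0; elim: d => [|d IHd].
  by rewrite rmorph1 rmorph1 expr1 pow_series0.
(* theta q^n = n q^n: the recurrence holds without fractions after
   multiplication by n, which is injective on integer coefficients. *)
suff: fps_of_poly (eulerian d.+1 \Po 'X^n) *+ n =
    pow_series d.+1 n * fps_of_poly (1 - 'X^n) ^+ d.+2 *+ n.
  move=> eq_n; apply: fpsP => j; apply: (pmulrnI n_gt0).
  by rewrite -!fps_mulrnE eq_n.
pose y : fps int := fps_of_poly 'X^n.
pose B : fps int := fps_of_poly ((eulerian d)^`() \Po 'X^n).
have ->: fps_of_poly (eulerian d.+1 \Po 'X^n) =
    (1 + d%:R * y) * fps_of_poly (eulerian d \Po 'X^n) + y * (1 - y) * B.
  rewrite /= scaler_nat mulr_natl !(comp_polyD, comp_polyM, comp_polyB).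
  rewrite !(rmorphD, rmorphM, rmorph1, rmorphMn) /= comp_polyX.
  by rewrite (rmorphN (comp_poly _)) /= comp_polyX rmorphN.
have XnE : 'X * 'X^(n.-1) = 'X^n :> {poly int} by rewrite -exprS prednK.
have thetay : theta y = y *+ n.
  by rewrite /y theta_poly derivXn mulrnAr XnE rmorphMn.
have thetaA : theta (fps_of_poly (eulerian d \Po 'X^n)) = y * B *+ n.
  rewrite theta_poly deriv_comp derivXn mulrCA !mulrnAr XnE rmorphMn /=.
  by rewrite rmorphM mulrC.
have -> : fps_of_poly (1 - 'X^n) = 1 - y :> fps int by rewrite rmorphB rmorph1.
rewrite -mulrnAl pow_seriesS //.
move: thetaA; rewrite IHd thetaM thetaX rmorphB rmorph1 -/y thetaB theta1 thetay.
rewrite /=; set S := pow_series d n; set z := 1 - y => thetaA.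
rewrite (_ : (_ + y * z * B) *+ n = (1 + d%:R * y) * (S * z ^+ d.+1) *+ n
   + z * (y * B *+ n)); last by ring.
rewrite -thetaA !exprS /z; ring.
Qed.

Lemma eulerian_quotient d n : (0 < n)%N ->
  fps_of_poly (eulerian d \Po 'X^n) / fps_of_poly (1 - 'X^n) ^+ d.+1 =
  pow_series d n.
Proof.
move=> n_gt0; rewrite eulerian_pow_series // mulrK // unitrX //.
by apply/unitrPr; exists (pow_series 0 n); rewrite mulrC pow_series0.
Qed.

(** * Counting with the partial products *)

(** The gap a_(i-1) - a_i at some level i, with the d offsets b_(i,j) - a_i. For
diamonds of m all of them are at most m, which makes this type finite. *)
Notation level d m := ('I_m.+1 * {ffun 'I_d -> 'I_m.+1})%type.

Definition admissible {d m} (s : level d m) : bool :=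
  [forall j, (s.2 j <= s.1)%N].

Definition level_codes (d N m : nat) : {set {ffun 'I_N -> level d m}} :=
  [set f : {ffun 'I_N -> level d m} | (f \in ffun_on admissible) &&
           (\sum_(i < N) i.+1 * (f i).1 == m)%N].

Lemma card_ord_le {m} (k : 'I_m.+1) : #|[pred x : 'I_m.+1 | (x <= k)%N]| = k.+1.
Proof.
rewrite -sum1_card (eq_bigl (fun x : 'I_m.+1 => (x < k.+1)%N)) //.
by rewrite -(big_ord_widen m.+1 (fun=> 1%N)) // sum1_card card_ord.
Qed.

(** The coefficient (k+1)^d is the number of families of d offsets that are
admissible for the gap k; gaps above m only affect degrees above m. *)
Lemma pow_series_levels d m n j : (0 < n)%N -> (j <= m)%N ->
  pow_series d n j =
  (\sum_(s : level d m | admissible s) fps_of_poly 'X^(n * s.1) : fps int) j.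
Proof.
move=> n_gt0 le_jm; rewrite fps_sumE.
rewrite -(pair_big_dep predT
  (fun (k : 'I_m.+1) (c : {ffun 'I_d -> 'I_m.+1}) => [forall i, (c i <= k)%N])
  (fun k _ => (fps_of_poly 'X^(n * k) : fps int) j)) /=.
have inner (k : 'I_m.+1) :
    \sum_(c : {ffun 'I_d -> 'I_m.+1} | [forall i, (c i <= k)%N])
      ('X^(n * k) : {poly int})`_j
    = if j == (n * k)%N then (k.+1 ^ d)%N%:Z else 0.
  rewrite sumr_const coefXn.
  rewrite (_ : #|_| = (k.+1 ^ d)%N).
    by case: ifP; rewrite ?natz ?mul0rn.
  rewrite -{1}(card_ord_le k) -[in RHS](card_ord d) -card_ffun_on.
  exact: eq_card.
rewrite (eq_bigr _ (fun k _ => inner k)) -big_mkcond /=.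
case: ifP => [/dvdnP[k jE]|ndv].
  have le_km : (k < m.+1)%N by move: le_jm; rewrite jE; nia.
  rewrite (big_pred1 (Ordinal le_km)) /= ?jE ?mulnK // => i.
  by rewrite mulnC eqn_pmul2l // eq_sym.
by rewrite big_pred0 // => k; apply: contraFF ndv => /eqP->; rewrite dvdn_mulr.
Qed.

Lemma fps_prod_eq_upto {R : comUnitRingType} {I : finType} {m}
    {F G : I -> fps R} :
  (forall i j, (j <= m)%N -> F i j = G i j) ->
  forall j, (j <= m)%N -> (\prod_i F i) j = (\prod_i G i) j.
Proof.
move=> eqFG; elim/big_rec2: _ => // i g f _ IH j le_jm.
rewrite !fpsME; apply: eq_bigr => k _; have := leq_ord k => le_kj.
by rewrite eqFG ?IH //; lia.
Qed.

(** Distributing the product over the sums chooses one gap and one family of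
offsets at each of the N levels. *)
Lemma coef_prod_pow_series d N m :
  (\prod_(1 <= n < N.+1) pow_series d n) m = #|level_codes d N m|%:Z.
Proof.
rewrite big_add1 big_mkord.
rewrite (fps_prod_eq_upto
  (fun (i : 'I_N) j => @pow_series_levels d m i.+1 j isT)) //.
rewrite bigA_distr_big fps_sumE -sum1_card.
rewrite [in RHS](eq_bigl (fun f : {ffun 'I_N -> level d m} =>
  (f \in ffun_on admissible) &&
  (\sum_(i < N) i.+1 * (f i).1 == m)%N)) => [|f]; last by rewrite inE.
rewrite [in RHS]big_mkcondr -natz natr_sum /=; apply: eq_bigr => f _.
by rewrite -rmorph_prod /= prodrXr coefXn eq_sym; case: eqP.
Qed.

(** * Diamonds as sequences of levels *)

(** The links are recovered from the gaps: a_i is the sum of the gaps at index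
l >= i. Levels are indexed from 0 here: the gap at index l is a_l - a_(l+1). *)
Definition link {d N m} (f : {ffun 'I_N -> level d m}) (i : nat) : nat :=
  (\sum_(l < N | (i <= l)%N) (f l).1)%N.

(** Beyond the N encoded levels every gap is 0, hence so is every offset. *)
Definition decode {d N m} (f : {ffun 'I_N -> level d m}) : diamond d :=
  (link f,
   fun i j =>
     link f i.+1 + oapp (fun l : 'I_N => (f l).2 j : nat) 0 (insub i))%N.

Definition encode {d N m} (D : diamond d) : {ffun 'I_N -> level d m} :=
  [ffun i : 'I_N => (inord (D.1 i - D.1 i.+1),
                     [ffun j => inord (D.2 i j - D.1 i.+1)])].

Lemma link_ge d N m (f : {ffun 'I_N -> level d m}) i :
  (N <= i)%N -> link f i = 0%N.
Proof.
by move=> le_Ni; apply: big_pred0 => l; apply/negbTE; have := ltn_ord l; lia.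
Qed.

Lemma link_lt d N m (f : {ffun 'I_N -> level d m}) (i : 'I_N) :
  link f i = ((f i).1 + link f i.+1)%N.
Proof.
rewrite /link (bigD1 i) //=; congr addn; apply: eq_bigl => l.
by rewrite -val_eqE /=; lia.
Qed.

(** The gap at index l occurs in the l + 1 links a_0, ..., a_l. *)
Lemma sum_link d N m (f : {ffun 'I_N -> level d m}) :
  (\sum_(i < N) link f i = \sum_(l < N) l.+1 * (f l).1)%N.
Proof.
rewrite (exchange_big_dep predT) //=; apply: eq_bigr => l _.
rewrite (eq_bigl (fun i : 'I_N => (i < l.+1)%N)) //.
rewrite -(big_ord_widen N (fun=> nat_of_ord (f l).1)) ?ltn_ord //.
by rewrite sum_nat_const card_ord.
Qed.

Lemma fsum_nat_ord (a : nat -> nat) N : (forall i, (N <= i)%N -> a i = 0%N) ->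
  \big[addn/0%N]_(i \in [set: nat]) a i = (\sum_(i < N) a i)%N.
Proof.
move=> a0; rewrite (fsbigE (iota 0 N)) ?iota_uniq //; last first.
  by move=> i _; rewrite mem_iota -leqNgt; apply: a0.
rewrite -(big_mkord predT a) /index_iota subn0.
by apply: eq_bigl => i; rewrite in_setT.
Qed.

Lemma encodeK d N m (f : {ffun 'I_N -> level d m}) : encode (decode f) = f.
Proof.
apply/ffunP => i; rewrite ffunE /= valK /= link_lt addnK inord_val.
case: (f i) => k c; congr pair; apply/ffunP => j.
by rewrite ffunE addKn inord_val.
Qed.

Lemma decode_schmidt d N m (f : {ffun 'I_N -> level d m}) :
  f \in level_codes d N m -> schmidt_diamonds d m (decode f).
Proof.
rewrite inE => /andP[/ffun_onP adm /eqP sum_f].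
have ineq i j : ((decode f).1 i.+1 <= (decode f).2 i j <= (decode f).1 i)%N.
  rewrite /= leq_addr /=; case: insubP => [l _ <-|]; last first.
    by rewrite -leqNgt => le_Ni; rewrite /= !link_ge //; lia.
  by rewrite link_lt /= addnC leq_add2r; move/forallP: (adm l); apply.
split; last by rewrite /= (fsum_nat_ord _ N) ?sum_link // => i; apply: link_ge.
split=> //.
  apply: (@sub_finite_set _ _ `I_N); last exact: finite_II.
  by move=> i /=; apply: contraNltn => /link_ge->.
apply: (@sub_finite_set _ _ (`I_N `*` [set: 'I_d])%classic); last first.
  by apply: finite_setX; [exact: finite_II|exact: finite_finset].
move=> [i j] /= b_neq0; split=> //=; apply: contraNltn b_neq0 => le_Ni.
by have /andP[_] := ineq i j; rewrite /= [leqRHS]link_ge // leqn0.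
Qed.

(** A diamond of m has a_i = 0 for i >= m, so its first N >= m levels determine
it; its entries are at most m, so that the encoding does not alter them. *)
Lemma schmidt_encode {d N m} {D : diamond d} : (0 < d)%N -> (m <= N)%N ->
  schmidt_diamonds d m D ->
  decode (encode D : {ffun 'I_N -> level d m}) = D /\
  (encode D : {ffun 'I_N -> level d m}) \in level_codes d N m.
Proof.
move=> d_gt0 le_mN SD; have bnd := schmidt_diamonds_bound d_gt0 SD.
case: SD => -[_ _ ineq] sum_a; set f : {ffun _ -> _} := encode D.
have a0 i : (N <= i)%N -> D.1 i = 0%N.
  by move=> le_Ni; have := bnd i; case: ltnP; lia.
have amono i : (D.1 i.+1 <= D.1 i)%N.
  by have /andP[/leq_trans] := ineq i (Ordinal d_gt0); apply.
have ale i : (D.1 i <= m)%N by have := bnd i; case: ifP; lia.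
have f1E (i : 'I_N) : (f i).1 = (D.1 i - D.1 i.+1)%N :> nat.
  by rewrite ffunE inordK //; have := ale i; lia.
have f2E (i : 'I_N) j : (f i).2 j = (D.2 i j - D.1 i.+1)%N :> nat.
  by rewrite !ffunE inordK //; have := ale i; have := ineq i j; lia.
have linkE i : link f i = D.1 i.
  have [le_Ni|lt_iN] := leqP N i; first by rewrite link_ge // a0.
  (* Downward induction on i, as the sums of gaps telescope from level N. *)
  have [k] := ubnP (N - i); elim: k i lt_iN => // k IHk i lt_iN lt_Nik.
  rewrite (link_lt _ _ _ _ (Ordinal lt_iN)) f1E /=.
  have [lt_i1N|le_Ni1] := ltnP i.+1 N; first by rewrite IHk ?subnK //; lia.
  by rewrite link_ge // (a0 i.+1) // subn0 addn0.
have decodeE : decode f = D.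
  rewrite [D]surjective_pairing; congr pair; first exact/funext.
  apply/funext => i; apply/funext => j; rewrite /= linkE.
  have := ineq i j; case: insubP => [l _ <-|]; first by rewrite /= f2E; lia.
  by rewrite -leqNgt /= => le_Ni; rewrite !a0 //; lia.
split=> //; rewrite inE -sum_link; apply/andP; split.
  apply/ffun_onP => i; apply/forallP => j.
  by rewrite f1E f2E leq_sub2r //; have /andP[] := ineq i j.
apply/eqP; transitivity (\sum_(i < N) D.1 i)%N.
  by apply: eq_bigr => i _; apply: linkE.
by rewrite -fsum_nat_ord.
Qed.

Lemma schmidt_count_codes {d N m} : (0 < d)%N -> (m <= N)%N ->
  schmidt_count d m = #|level_codes d N m|.
Proof.
move=> d_gt0 le_mN.
have -> : schmidt_count d m = #|` [fset decode f | f in level_codes d N m]%fset|.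
  congr #|` _|; apply/fsetP => D.
  rewrite in_fset_set; last exact: finite_schmidt_diamonds.
  apply/idP/imfsetP => [/set_mem SD|[f Af ->]]; last first.
    exact/mem_set/decode_schmidt.
  have [DE codeD] := schmidt_encode d_gt0 le_mN SD.
  by exists (encode D).
rewrite card_imfset /=; last exact: can_inj (encodeK d N m).
by rewrite -cardE.
Qed.

Theorem theorem1p2 (d : nat) (d_ge1 : (1 <= d)%N) :
  infprod_to
    (fun n => fps_of_poly (eulerian d \Po 'X^n)
              / fps_of_poly (1 - 'X^n) ^+ d.+1)
    (schmidt_gf d).
Proof.
move=> m; exists m => // N /= le_mN.
rewrite (schmidt_count_codes d_ge1 le_mN) -coef_prod_pow_series.
congr (fcoef _ m); apply: eq_big_nat => n /andP[n_gt0 _].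
exact: eulerian_quotient.
Qed.
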